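(* Assume that $\{S_j : j\in J\}$ is a family of measurable subsets of $\mathbb{R}^d$ of positive finite measure forming a covering of $\mathbb{R}^d$, and let $\{h_j : j\in J\}$ be a Riesz partition of unity with bounds $p$ and $P$ associated to $\{S_j\}_{j\in J}$. Let $x_{j,k}\in\mathbb{R}^d$ ($j\in J$, $k\in K$) and assume that for each $j\in J$, $\{\mu(S_j)^{-1/2}e_{x_{j,k}}\chi_{S_j} : k\in K\}$ is a frame for $\mathcal{K}_{S_j}$ with lower and upper frame bounds $m_j$ and $M_j$ respectively. If $m:=\inf_j m_j>0$ and $M:=\sup_j M_j<+\infty$, then $$\{\mu(S_j)^{-1/2}h_je_{x_{j,k}} : j\in J,\ k\in K\}$$ is a frame for $L^2(\mathbb{R}^d)$ with frame bounds $mp$ and $MP$.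
   Context: $J$ and $K$ are countable index sets, $\mu$ is Lebesgue measure, $e_x(\xi)=e^{-i2\pi x\cdot\xi}$, and $\chi_S$ is the characteristic function of $S$. A Riesz partition of unity with bounds $0<p\le P<+\infty$ associated to $\{S_j\}_{j\in J}$ is a set $\{h_j\}_{j\in J}$ of measurable functions on $\mathbb{R}^d$ with $\operatorname{supp}h_j\subseteq S_j$ for all $j$ and $p\le\sum_{j\in J}|h_j(x)|^2\le P$ for a.e. $x\in\bigcup_jS_j$. For measurable $Q\subset\mathbb{R}^d$, $\mathcal{K}_Q=\{f\in L^2(\mathbb{R}^d) : \operatorname{supp}(f)\subset\overline{Q}\}$. A set of functions $\{g_j\}$ is a frame for a closed subspace $F$ of $L^2(\mathbb{R}^d)$ with lower and upper bounds $m,M$ ($0<m,M<+\infty$) if $g_j\in F$ for all $j$ and $m\|f\|^2\le\sum_j|\langle f,g_j\rangle|^2\le M\|f\|^2$ for all $f\in F$. *)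

(* Defs.v *)
From HB Require Import structures.
From mathcomp Require Import all_boot all_order all_algebra.
From mathcomp Require Import complex.
From mathcomp Require Import all_classical all_reals all_analysis.

Set Implicit Arguments.
Unset Strict Implicit.
Unset Printing Implicit Defensive.
Import Order.TTheory GRing.Theory Num.Theory.
Import numFieldNormedType.Exports.

Local Open Scope classical_set_scope.
Local Open Scope ring_scope.

(* Lebesgue measure on R^d with its full (complete) sigma-algebra, obtained by
   Caratheodory's construction from the outer measure
   A |-> inf { sum of the volumes of the boxes of C |
               C a countable family of boxes covering A }. *)
Section lebesgue_outer.
Context {R : realType} {d : nat}.
Local Open Scope ereal_scope.

Definition box (c : 'rV[R]_d * 'rV[R]_d) : set 'rV[R]_d :=
  [set x | forall i, (c.1 ord0 i <= x ord0 i <= c.2 ord0 i)%R].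

Definition box_volume (c : 'rV[R]_d * 'rV[R]_d) : R :=
  (\prod_(i < d) Num.max 0 (c.2 ord0 i - c.1 ord0 i))%R.

Definition box_cover (A : set 'rV[R]_d) : set (set ('rV[R]_d * 'rV[R]_d)) :=
  [set C | countable C /\ A `<=` \bigcup_(c in C) box c].

Definition lebesgue_outer (A : set 'rV[R]_d) : \bar R :=
  ereal_inf [set \esum_(c in C) (box_volume c)%:E | C in box_cover A].

Lemma box_volume_ge0 c : (0 <= box_volume c)%R.
Proof. by apply: prodr_ge0 => i _; rewrite le_max lexx. Qed.

Lemma lebesgue_outer_ge0 A : 0 <= lebesgue_outer A.
Proof.
apply: le_ereal_inf_tmp => _ [C _ <-].
by apply: esum_ge0 => c _; rewrite lee_fin box_volume_ge0.
Qed.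

Lemma lebesgue_outer0 : lebesgue_outer set0 = 0.
Proof.
apply/eqP; rewrite eq_le lebesgue_outer_ge0 andbT.
by apply: ereal_inf_lbound; exists set0; [split | rewrite esum_set0].
Qed.

Lemma le_lebesgue_outer : {homo lebesgue_outer : A B / A `<=` B >-> A <= B}.
Proof.
move=> A B AB; apply: ereal_inf_le_tmp => _ [C [cC BC] <-].
by exists C => //; split => //; exact: subset_trans AB BC.
Qed.

Lemma lebesgue_outer_sigma_subadditive : sigma_subadditive lebesgue_outer.
Proof.
move=> A; have [[i ioo]|] := pselect (exists i, lebesgue_outer (A i) = +oo).
  rewrite (eseries_pinfty _ _ ioo) ?leey// => n _.
  by rewrite -ltNye (lt_le_trans _ (lebesgue_outer_ge0 _)).
rewrite -forallNE => Aoo.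
suff add2e (e : {posnum R}) : lebesgue_outer (\bigcup_n A n) <=
    \sum_(i <oo) lebesgue_outer (A i) + e%:num%:E.
  by apply/lee_addgt0Pr => _/posnumP[].
rewrite (le_trans _ (epsilon_trick _ _ _))//; last first.
  by move=> n; exact: lebesgue_outer_ge0.
pose V (c : 'rV[R]_d * 'rV[R]_d) := (box_volume c)%:E.
have V0 c : 0 <= V c by rewrite lee_fin box_volume_ge0.
pose P n C := box_cover (A n) C /\
  \esum_(c in C) V c <= lebesgue_outer (A n) + (e%:num / (2 ^ n.+1)%:R)%:E.
have [G PG] : {G & forall n, P n (G n)}.
  apply: (@choice _ _ P) => n; rewrite /P.
  have fA : lebesgue_outer (A n) \is a fin_num.
    by rewrite ge0_fin_numE ?lebesgue_outer_ge0// ltey; apply/eqP/Aoo.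
  have en1 : (0 < e%:num / (2 ^ n.+1)%:R)%R by [].
  have [_ [C cC <-] CA] := lb_ereal_inf_adherent en1 fA.
  by exists C; split => //; exact/ltW.
apply: (@le_trans _ _ (\esum_(c in \bigcup_n G n) V c)).
  apply: ereal_inf_lbound; exists (\bigcup_n G n) => //; split.
    by apply: bigcup_countable => // n _; exact: (PG n).1.1.
  move=> x [n _ /((PG n).1.2) [c Gc cx]].
  by exists c => //; exists n.
rewrite seqDU_bigcup_eq esum_bigcupT// nneseries_esumT; last first.
  by move=> n; rewrite adde_ge0// lebesgue_outer_ge0.
apply: le_esum => n _; apply: le_trans (PG n).2.
apply: ge_ereal_sup => _ [X [finX XG] <-]; apply: ereal_sup_ubound.
by exists X => //; split => //; exact: subset_trans XG (@subset_seqDU _ _ _).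
Qed.

HB.instance Definition _ := isOuterMeasure.Build R 'rV[R]_d lebesgue_outer
  lebesgue_outer0 lebesgue_outer_ge0 le_lebesgue_outer
  lebesgue_outer_sigma_subadditive.

End lebesgue_outer.

Definition euclidean (R : realType) (d : nat) :=
  caratheodory_type (@lebesgue_outer R d).

HB.instance Definition _ (R : realType) (d : nat) :=
  Measurable.on (euclidean R d).

Definition lebesgue_rV {R : realType} {d : nat} :
  set (euclidean R d) -> \bar R := @lebesgue_outer R d.

HB.instance Definition _ (R : realType) (d : nat) :=
  isMeasure.Build _ _ _ (@lebesgue_rV R d)
    (@caratheodory_measure0 _ _ (@lebesgue_outer R d))
    (@caratheodory_measure_ge0 _ _ (@lebesgue_outer R d))
    (@caratheodory_measure_sigma_additive _ _ (@lebesgue_outer R d)).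

(* Functions T -> R[i] represent elements of L^2(mu) up to a.e. equality. *)
Section L2.
Context d (T : measurableType d) (R : realType) (mu : {measure set T -> \bar R}).
Implicit Types (f g : T -> R[i]) (A : set T) (I : countType).

Definition cmeasurable f :=
  measurable_fun [set: T] (fun x => complex.Re (f x)) /\
  measurable_fun [set: T] (fun x => complex.Im (f x)).

Definition norm2_sq f : \bar R := (\int[mu]_x (Normc.normc (f x) ^+ 2)%:E)%E.

Definition L2 : set (T -> R[i]) :=
  [set f | cmeasurable f /\ (norm2_sq f < +oo)%E].

Definition inner f g : R[i] :=
  let fg x := f x * conjc (g x) in
  Complex (\int[mu]_x complex.Re (fg x)) (\int[mu]_x complex.Im (fg x)).

(* [supp f] is contained in [A], up to a null set. *)
Definition supp_sub f A := {ae mu, forall x, f x != 0 -> A x}.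

Definition frame (F : set (T -> R[i])) I (g : I -> T -> R[i]) (m M : R) :=
  [/\ 0 < m, 0 < M, forall i, F (g i) &
      forall f, F f ->
        (m%:E * norm2_sq f <=
           \esum_(i in [set: I]) (Normc.normc (inner f (g i)) ^+ 2)%:E <=
         M%:E * norm2_sq f)%E].

Definition Riesz_partition I (S : I -> set T) (h : I -> T -> R[i]) (p P : R) :=
  [/\ 0 < p <= P,
      forall j, cmeasurable (h j),
      forall j, supp_sub (h j) (S j) &
      {ae mu, forall x, (\bigcup_j S j) x ->
        (p%:E <= \esum_(j in [set: I]) (Normc.normc (h j x) ^+ 2)%:E <= P%:E)%E}].

End L2.

Section euclidean_frames.
Context {R : realType} {d : nat}.
Local Open Scope complex_scope.

Definition character (x xi : euclidean R d) : R[i] :=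
  let t := 2 * pi * \sum_(i < d) (x : 'rV[R]_d) ord0 i * (xi : 'rV[R]_d) ord0 i in
  cos t -i* sin t.

Definition supported_L2 (Q : set (euclidean R d)) : set (euclidean R d -> R[i]) :=
  [set f | L2 lebesgue_rV f /\
           supp_sub lebesgue_rV f (closure (Q : set 'rV[R]_d))].

(* mu(Q)^(-1/2), meaningful when 0 < mu(Q) < +oo *)
Definition rsqrt_measure (Q : set (euclidean R d)) : R :=
  (Num.sqrt (fine (lebesgue_rV Q)))^-1.

End euclidean_frames.

(* Main.v *)
(* Put u_j = f conj(h_j), which is supported in S_j. Then
   <f, h_j e_jk> = <u_j, e_jk 1_(S_j)>, so the frame inequalities on S_j, applied
   to u_j and summed over j, bound sum_jk |<f, h_j e_jk>|^2 below and above by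
   m and M times sum_j ||u_j||^2. By monotone convergence the latter equals
   int |f|^2 sum_j |h_j|^2, which lies between p ||f||^2 and P ||f||^2. *)
Require Import Defs.
From HB Require Import structures.
From mathcomp Require Import all_boot all_order all_algebra.
From mathcomp Require Import complex.
From mathcomp Require Import all_classical all_reals all_analysis.
From mathcomp Require Import measurable_realfun.
Import Order.TTheory GRing.Theory Num.Theory.
Import numFieldNormedType.Exports.
Local Open Scope classical_set_scope.
Local Open Scope ring_scope.
Local Open Scope complex_scope.

(** * Sums of nonnegative extended reals over a countable type *)

Section esum_countType.
Context {R : realType} {I : countType}.
Implicit Types a : I -> \bar R.
Local Open Scope ereal_scope.

(** The encoding [pickle] turns the sum into a series over the naturals, to which results on series
    apply; a natural that encodes no index contributes the default value 0. *)
Lemma esum_nneseries a : (forall i, 0 <= a i) ->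
  \esum_(i in [set: I]) a i = \sum_(n <oo) oapp a 0 (pickle_inv n).
Proof.
move=> a0; have b0 n : 0 <= oapp a 0 (pickle_inv n) by case: pickle_inv.
rewrite nneseries_esumT//.
transitivity (\esum_(n in range (@pickle I)) oapp a 0 (pickle_inv n)).
  rewrite esum_image; last by move=> i j _ _; exact: (pcan_inj pickleK).
  by apply: eq_esum => i _; rewrite pickleK_inv.
rewrite esum_mkcond; apply: eq_esum => n _; case: ifPn => // nI.
case E : (pickle_inv n) => [i|//].
case/negP: nI; rewrite inE; exists i => //.
by have := @pickle_invK I n; rewrite E.
Qed.

Lemma esumZl (c : R) a : (forall i, 0 <= a i) -> (0 <= c)%R ->
  \esum_(i in [set: I]) (c%:E * a i) = c%:E * \esum_(i in [set: I]) a i.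
Proof.
move=> a0 c0; rewrite !esum_nneseries//; last first.
  by move=> i; rewrite mule_ge0.
rewrite -nneseriesZl; last by move=> n _; case: pickle_inv.
by apply: eq_eseriesr => n _; case: pickle_inv => //=; rewrite mule0.
Qed.

Context {d} {T : measurableType d}.
Context {F : I -> T -> \bar R} (F0 : forall i x, 0 <= F i x).
Context (mF : forall i, measurable_fun [set: T] (F i)).

Lemma measurable_fun_esum :
  measurable_fun [set: T] (fun x => \esum_(i in [set: I]) F i x).
Proof.
have -> : (fun x => \esum_(i in [set: I]) F i x) =
    fun x => \sum_(n <oo) oapp (F^~ x) 0 (pickle_inv n).
  by apply/funext => x; rewrite esum_nneseries.
apply: (@ge0_emeasurable_sum _ _ _ _
  (fun n x => oapp (F^~ x) 0 (pickle_inv n)) xpredT).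
- by move=> n x _ _; case: pickle_inv => //=.
- move=> n _; case: (@pickle_inv I n) => [i|]; [exact: mF|].
  exact: measurable_cst.
Qed.

(** Monotone convergence, carried over from series through the enumeration of [I]. *)
Lemma integral_esum (mu : {measure set T -> \bar R}) :
  \int[mu]_x (\esum_(i in [set: I]) F i x) =
  \esum_(i in [set: I]) \int[mu]_x F i x.
Proof.
rewrite esum_nneseries; last by move=> i; exact: integral_ge0.
under eq_integral do rewrite esum_nneseries//.
rewrite (@integral_nneseries _ _ _ mu setT measurableT
  (fun n x => oapp (F^~ x) 0 (pickle_inv n)))//.
- apply: eq_eseriesr => n _; case: pickle_inv => //=; exact: integral0.
- move=> n; case: (@pickle_inv I n) => [i|]; [exact: mF|].
  exact: measurable_cst.
- by move=> n x _; case: pickle_inv => //=.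
Qed.

End esum_countType.

(** * Measurability, squared norms and inner products of complex functions *)

Section complex_functions.
Context {d} {T : measurableType d} {R : realType}.
Context {mu : {measure set T -> \bar R}}.
Implicit Types f g : T -> R[i].

(** Squaring removes the root in the modulus and leaves a polynomial in the real and imaginary
    parts, whose measurability is immediate. *)
Lemma normc_sqE (z : R[i]) :
  Normc.normc z ^+ 2 = complex.Re z ^+ 2 + complex.Im z ^+ 2.
Proof. by case: z => a b /=; rewrite sqr_sqrtr// addr_ge0// sqr_ge0. Qed.

Lemma normc_conj_sq (z : R[i]) : Normc.normc z^*%C ^+ 2 = Normc.normc z ^+ 2.
Proof. by rewrite !normc_sqE; case: z => a b /=; rewrite sqrrN. Qed.

Lemma cmeasurableM f g : cmeasurable f -> cmeasurable g ->
  cmeasurable (fun x => f x * g x).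
Proof.
move=> [fr fi] [gr gi]; split.
- rewrite (_ : (fun x => _) = (fun x => complex.Re (f x) * complex.Re (g x) -
      complex.Im (f x) * complex.Im (g x))).
    by apply: measurable_funB; exact: measurable_funM.
  by apply/funext => x; case: (f x) (g x) => [? ?] [].
- rewrite (_ : (fun x => _) = (fun x => complex.Re (f x) * complex.Im (g x) +
      complex.Im (f x) * complex.Re (g x))).
    by apply: measurable_funD; exact: measurable_funM.
  by apply/funext => x; case: (f x) (g x) => [? ?] [].
Qed.

Lemma cmeasurable_conj f : cmeasurable f -> cmeasurable (fun x => (f x)^*%C).
Proof.
move=> [fr fi]; split.
- by rewrite (_ : (fun x => _) = (fun x => complex.Re (f x)))//;
    apply/funext => x; case: (f x).
- rewrite (_ : (fun x => _) = (fun x => - complex.Im (f x))).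
    exact: measurableT_comp.
  by apply/funext => x; case: (f x).
Qed.

Lemma measurable_normc_sq f : cmeasurable f ->
  measurable_fun [set: T] (fun x => (Normc.normc (f x) ^+ 2)%:E).
Proof.
move=> [fr fi]; apply/measurable_EFinP.
under eq_fun do rewrite normc_sqE.
by apply: measurable_funD; exact: measurable_funX.
Qed.

Lemma ae_cmeasurable f g : measure_is_complete mu ->
  {ae mu, forall x, f x = g x} -> cmeasurable f -> cmeasurable g.
Proof.
move=> cmu fg [fr fi]; split; apply/measurable_EFinP.
- move/measurable_EFinP: fr; apply: (ae_measurable_fun cmu).
  by apply: filterS fg => x /= ->.
- move/measurable_EFinP: fi; apply: (ae_measurable_fun cmu).
  by apply: filterS fg => x /= ->.
Qed.

Lemma ae_le_norm2_sq f g : cmeasurable f -> cmeasurable g ->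
  {ae mu, forall x, Normc.normc (f x) ^+ 2 <= Normc.normc (g x) ^+ 2} ->
  (norm2_sq mu f <= norm2_sq mu g)%E.
Proof.
move=> mf mg fg; apply: ae_ge0_le_integral => //.
- by move=> x _; rewrite lee_fin sqr_ge0.
- exact: measurable_normc_sq.
- by move=> x _; rewrite lee_fin sqr_ge0.
- exact: measurable_normc_sq.
- by apply: filterS fg => x /= fg _; rewrite lee_fin.
Qed.

Lemma norm2_sqZ (c : R) f : cmeasurable f ->
  norm2_sq mu (fun x => c%:C * f x) = ((c ^+ 2)%:E * norm2_sq mu f)%E.
Proof.
move=> mf; rewrite /norm2_sq.
under eq_integral do rewrite Normc.normcM exprMn normc_sqE/= expr0n addr0 EFinM.
rewrite ge0_integralZl_EFin ?sqr_ge0//.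
- by move=> x _; rewrite lee_fin sqr_ge0.
- exact: measurable_normc_sq.
Qed.

Lemma cmeasurable_cst (c : R[i]) : cmeasurable (fun _ : T => c).
Proof. by split; exact: measurable_cst. Qed.

(** Domination by [Num.sqrt c] times [f], whose squared norm is [c] times that of [f], hence
    finite. *)
Lemma L2_bounded (c : R) f g : L2 mu f -> cmeasurable g -> 0 <= c ->
  {ae mu, forall x, Normc.normc (g x) ^+ 2 <= c * Normc.normc (f x) ^+ 2} ->
  L2 mu g.
Proof.
move=> [mf foo] mg c0 gf; split => //.
have mcf : cmeasurable (fun x => (Num.sqrt c)%:C * f x).
  by apply: cmeasurableM => //; exact: cmeasurable_cst.
apply: (@le_lt_trans _ _ (norm2_sq mu (fun x => (Num.sqrt c)%:C * f x))).
  apply: ae_le_norm2_sq => //; apply: filterS gf => x /=.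
  by rewrite Normc.normcM exprMn [X in _ -> _ <= X * _]normc_sqE/=
    expr0n addr0 sqr_sqrtr.
by rewrite norm2_sqZ// lte_mul_pinfty// lee_fin sqr_ge0.
Qed.

(** The inner product depends only on the a.e. class of the product of one function with the
    conjugate of the other, so a factor can pass from one argument to the other. *)
Lemma ae_inner f g f' g' :
  cmeasurable f -> cmeasurable g -> cmeasurable f' -> cmeasurable g' ->
  {ae mu, forall x, f x * (g x)^*%C = f' x * (g' x)^*%C} ->
  inner mu f g = inner mu f' g'.
Proof.
move=> mf mg mf' mg' fg.
have [r i] := cmeasurableM _ _ mf (cmeasurable_conj _ mg).
have [r' i'] := cmeasurableM _ _ mf' (cmeasurable_conj _ mg').
rewrite /inner /Rintegral; congr (Complex (fine _) (fine _));
  (apply: ae_eq_integral => //; [exact/measurable_EFinP|exact/measurable_EFinP|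
    by apply: filterS fg => x /= ->]).
Qed.

(** * Riesz partitions of unity and the gluing of local frames *)

Lemma Riesz_partition_norm2_sq {J : countType} {S : J -> set T}
    {h : J -> T -> R[i]} {p P : R} {f} :
  Riesz_partition mu S h p P -> \bigcup_j S j = [set: T] -> cmeasurable f ->
  (p%:E * norm2_sq mu f <=
    \esum_(j in [set: J]) norm2_sq mu (fun x => f x * (h j x)^*%C)%R <=
   P%:E * norm2_sq mu f)%E.
Proof.
move=> [/andP[p0 pP] mh _ hpP] ST mf.
have P0 : 0 <= P by rewrite (le_trans _ pP)// ltW.
have mfh j : cmeasurable (fun x => f x * (h j x)^*%C).
  by apply: cmeasurableM => //; exact: cmeasurable_conj.
have n0 (z : R[i]) : (0 <= (Normc.normc z ^+ 2)%:E)%E.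
  by rewrite lee_fin sqr_ge0.
have nM x j : ((Normc.normc (f x * (h j x)^*%C)%R ^+ 2)%:E =
    (Normc.normc (f x) ^+ 2)%:E * (Normc.normc (h j x) ^+ 2)%:E)%E.
  by rewrite Normc.normcM exprMn normc_conj_sq EFinM.
rewrite -(integral_esum _ (fun j => measurable_normc_sq _ (mfh j)))//.
have mE := measurable_fun_esum (fun j x => n0 (f x * (h j x)^*%C))
  (fun j => measurable_normc_sq _ (mfh j)).
have mfn := measurable_normc_sq _ mf.
rewrite /norm2_sq -!ge0_integralZl_EFin ?(ltW p0)//.
apply/andP; split; apply: ae_ge0_le_integral => //.
- by move=> x _; rewrite mule_ge0// lee_fin ltW.
- exact: measurable_funeM.
- by move=> x _; exact: esum_ge0.
(* Since the [S j] cover the space, the bounds of the partition hold at a.e. point; the factor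
   [|f x|^2] then comes out of the sum over [j]. *)
- apply: filterS hpP => x /=; rewrite ST => /(_ I)/andP[ph _] _.
  under eq_esum do rewrite nM.
  by rewrite esumZl ?sqr_ge0// muleC lee_wpmul2l.
- by move=> x _; exact: esum_ge0.
- by move=> x _; rewrite mule_ge0.
- exact: measurable_funeM.
- apply: filterS hpP => x /=; rewrite ST => /(_ I)/andP[_ hP] _.
  under eq_esum do rewrite nM.
  by rewrite esumZl ?sqr_ge0// [leRHS]muleC lee_wpmul2l.
Qed.

(** A single term exceeding [P] would push the whole nonnegative sum above [P]. *)
Lemma Riesz_partition_le {J : countType} {S : J -> set T}
    {h : J -> T -> R[i]} {p P : R} :
  Riesz_partition mu S h p P -> \bigcup_j S j = [set: T] ->
  forall j, {ae mu, forall x, Normc.normc (h j x) ^+ 2 <= P}.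
Proof.
move=> [_ _ _ hpP] ST j; apply: filterS hpP => x /=; rewrite ST.
move=> /(_ I)/andP[_]; apply: contraTT; rewrite -!ltNge => Ph.
rewrite -lte_fin in Ph; apply: (lt_le_trans Ph).
by apply: esum_ge; exists [set j]; [split|rewrite fsbig_set1].
Qed.

(** The spaces [F j] are only required to lie between the L2 functions supported a.e. in [S j] and
    all of L2. This leaves room for supports in the closure of [S j], which may exceed [S j] by a
    set of positive measure. *)
Lemma frame_Riesz_partition {J K : countType} {S : J -> set T}
    {h : J -> T -> R[i]} {p P : R} {F : J -> set (T -> R[i])}
    {e : J -> K -> T -> R[i]} {mj Mj : J -> R} {m M : R} :
  measure_is_complete mu ->
  Riesz_partition mu S h p P -> \bigcup_j S j = [set: T] ->
  (forall j, F j `<=` L2 mu) ->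
  (forall j, L2 mu `&` [set f | supp_sub mu f (S j)] `<=` F j) ->
  (forall j, frame mu (F j) (fun k x => e j k x * (\1_(S j) x)%:C)
    (mj j) (Mj j)) ->
  0 < m -> 0 < M -> (forall j, m <= mj j) -> (forall j, Mj j <= M) ->
  frame mu (L2 mu) (fun (jk : J * K) x => h jk.1 x * e jk.1 jk.2 x)
    (m * p) (M * P).
Proof.
move=> cmu hp ST FL2 L2F Sframe m0 M0 mmj MjM.
have [/andP[p0 pP] mh + _] := hp; rewrite /supp_sub => hS.
have P0 : 0 < P by exact: lt_le_trans p0 pP.
set E := fun j k x => e j k x * (\1_(S j) x)%:C.
set G := fun jk : J * K => _.
have EL2 j k : L2 mu (E j k) by have [_ _ /(_ k)/FL2] := Sframe j.
have mE j k : cmeasurable (E j k) by have [] := EL2 j k.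
(* Almost everywhere, either [h j] vanishes or the point lies in [S j], where the indicator is 1. *)
have GE j k : {ae mu, forall x, h j x * E j k x = G (j, k) x}.
  apply: filterS (hS j) => x /= hSx; rewrite /E /G /=.
  have [->|/hSx Sx] := eqVneq (h j x) 0; first by rewrite !mul0r.
  by rewrite indicE mem_set// mulr1.
(* The functions [e j k] are only known to be measurable on [S j]; completeness
   of [mu] takes care of the null set where [h j] lives outside [S j]. *)
have mG j k : cmeasurable (G (j, k)).
  by apply: (ae_cmeasurable _ _ cmu (GE j k)); exact: cmeasurableM.
have h_le := Riesz_partition_le hp ST.
split; [exact: mulr_gt0|exact: mulr_gt0| |].
  (* As [|h j|^2 <= P] a.e., [|G (j, k)|^2] is at most [P] times [|E j k|^2]. *)
  move=> [j k]; apply: (@L2_bounded P (E j k)) => //.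
    exact: ltW.
  apply: filterS2 (GE j k) (h_le j) => x /= <- hP.
  by rewrite Normc.normcM exprMn ler_wpM2r// sqr_ge0.
move=> f fL2; have [mf _] := fL2.
pose u j x := f x * (h j x)^*%C.
have m_u j : cmeasurable (u j).
  by apply: cmeasurableM => //; exact: cmeasurable_conj.
have uF j : F j (u j).
  apply: L2F; split.
    apply: (@L2_bounded P f) => //; first exact: ltW.
    apply: filterS (h_le j) => x /= hP.
    by rewrite Normc.normcM exprMn normc_conj_sq mulrC ler_wpM2r// sqr_ge0.
  rewrite /= /supp_sub; apply: filterS (hS j) => x /= hSx ux; apply: hSx.
  by apply: contra_neq ux; rewrite /u => ->; rewrite conjc0 mulr0.
have innerE j k : inner mu f (G (j, k)) = inner mu (u j) (E j k).
  apply: ae_inner => //; apply: filterS (GE j k) => x /= <-.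
  by rewrite /u rmorphM/= mulrA.
have -> : (\esum_(jk in [set: J * K])
      (Normc.normc (inner mu f (G jk)) ^+ 2)%:E =
    \esum_(j in [set: J]) \esum_(k in [set: K])
      (Normc.normc (inner mu (u j) (E j k)) ^+ 2)%:E)%E.
  rewrite esum_esum; last by move=> j k _ _; rewrite lee_fin sqr_ge0.
  rewrite (_ : _ `*`` _ = setT); last by apply/seteqP; split.
  by apply: eq_esum => -[j k] _; rewrite innerE.
have /andP[pu uP] := Riesz_partition_norm2_sq hp ST mf.
have n0 g : (0 <= norm2_sq mu g)%E.
  by apply: integral_ge0 => x _; rewrite lee_fin sqr_ge0.
rewrite !EFinM -!muleA; apply/andP; split.
(* The constant [m] enters the sum over [j] and is replaced term by term by the larger [mj j]; the
   upper bound is symmetric. *)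
- apply: (le_trans (lee_wpmul2l _ pu)); first by rewrite lee_fin ltW.
  rewrite -esumZl ?(ltW m0)//; apply: le_esum => j _.
  have [_ _ _ /(_ _ (uF j))/andP[+ _]] := Sframe j; apply: le_trans.
  by rewrite lee_wpmul2r// lee_fin.
- apply: le_trans (lee_wpmul2l _ uP); last by rewrite lee_fin ltW.
  rewrite -esumZl ?(ltW M0)//; apply: le_esum => j _.
  have [_ _ _ /(_ _ (uF j))/andP[_ +]] := Sframe j => /le_trans; apply.
  by rewrite lee_wpmul2r// lee_fin.
Qed.

End complex_functions.

(** * Application to Lebesgue measure and characters *)

Theorem proposition5p7 (R : realType) (d : nat) (J K : countType)
    (S : J -> set (euclidean R d)) (h : J -> euclidean R d -> R[i]) (p P : R)
    (x : J -> K -> euclidean R d) (mj Mj : J -> R) (m M : R)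
    (S_measurable : forall j, measurable (S j))
    (S_measure : forall j, (0 < lebesgue_rV (S j) < +oo)%E)
    (S_cover : \bigcup_j S j = [set: euclidean R d])
    (h_partition : Riesz_partition lebesgue_rV S h p P)
    (S_frame : forall j,
       frame lebesgue_rV (supported_L2 (S j))
         (fun (k : K) xi =>
            (rsqrt_measure (S j))%:C * character (x j k) xi * (\1_(S j) xi)%:C)
         (mj j) (Mj j))
    (m_inf : ereal_inf [set (mj j)%:E | j in [set: J]] = m%:E)
    (m_gt0 : 0 < m)
    (M_sup : ereal_sup [set (Mj j)%:E | j in [set: J]] = M%:E) :
  frame lebesgue_rV (L2 lebesgue_rV)
    (fun (jk : J * K) xi =>
       (rsqrt_measure (S jk.1))%:C * h jk.1 xi * character (x jk.1 jk.2) xi)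
    (m * p) (M * P).
Proof.
have cmu : measure_is_complete (@lebesgue_rV R d).
  exact: measure_is_complete_caratheodory.
have MjM j : Mj j <= M.
  by rewrite -lee_fin -M_sup; apply: ereal_sup_ubound; exists j.
(* The normalizing factor joins the character, so that their product plays the role of [e j k]. *)
rewrite (_ : (fun jk => _) = fun (jk : J * K) xi => h jk.1 xi *
    ((rsqrt_measure (S jk.1))%:C * character (x jk.1 jk.2) xi)); last first.
  by apply/funext => jk; apply/funext => xi; rewrite mulrCA mulrA.
apply: (frame_Riesz_partition cmu h_partition S_cover _ _ S_frame) => //.
- by move=> j f [].
- move=> j f [fL2 fS]; split => //; move: fS.
  rewrite /= /supp_sub; apply: filterS => xi /= fS /fS.
  exact: subset_closure.
(* Positivity of [M] needs some index: the origin lies in some [S j], and then [0 < Mj j <= M]. *)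
- have : (\bigcup_j S j) (0 : 'rV[R]_d) by rewrite S_cover.
  by move=> [j _ _]; have [_ Mj0 _ _] := S_frame j; exact: lt_le_trans (MjM j).
- by move=> j; rewrite -lee_fin -m_inf; apply: ereal_inf_lbound; exists j.
Qed.
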